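(* Consider the closed-loop system $\dot x=K^{-1}f(x)$ on $\mathbb{X}=\mathbb{M}^n\times\mathbb{R}^{10n+m}$ described in the context, and suppose that Assumption A (frequency and dc voltage regulation; see context) holds. Then the system admits a unique equilibrium set, given by $$\Omega^\star=\left\{(\delta^\star,y^\star)\ \middle|\ \delta_j^\star\in\{\delta_{\mathrm{r},j},\ \delta_{\mathrm{r},j}+2\pi\}\ \text{for all } j\in\{1,\dots,n\}\right\},$$ where $y^\star\in\mathbb{R}^{10n+m}$ is a single vector, uniquely determined with respect to $(\delta_{\mathrm r},v_{\mathrm{dc,r}},\omega_{\mathrm r})$. In particular, $\Omega^\star$ consists only of disjoint (isolated) points that differ from each other only in their angle components.
   Context: **Angles.** $\mathbb{M}$ denotes the boundary of a Möbius strip, identified with $\mathbb{R}/4\pi\mathbb{Z}$ (the interval $[-2\pi,2\pi]$ with $-2\pi\equiv 2\pi$), so $\sin(\cdot/2)$ and $\cos(\cdot/2)$ are well defined on $\mathbb{M}$. **Data.** $n,m\in\mathbb{Z}_{>0}$. For $j=1,\dots,n$ there are positive constants $J_j, D_{\mathrm f,j}, D_{\mathrm d,j}, \tau_{\mathrm g,j},\kappa_{\mathrm g,j},b_j$ (ac grid), $L_{\mathrm g,j},R_{\mathrm g,j}$ (ac line), $\tau_{\mathrm{dc},j},\kappa_{\mathrm{dc},j},C_{\mathrm{dc},j},G_{\mathrm{dc},j},L_j,R_j,C_j,G_j$ (converter), $\eta_j,\gamma_j$ (control gains); modulation magnitudes $\mu_j\in[0,1/2]$; and references $\omega_{\mathrm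 r,j}>0$, $T_{\mathrm r,j}, i_{\mathrm{dc,r},j}, v_{\mathrm{dc,r},j}\in\mathbb{R}$, $\delta_{\mathrm r,j}\in\mathbb{M}$. For $k=1,\dots,m$ there are positive dc line constants $L_{\mathrm{dc},k},R_{\mathrm{dc},k}$. $B\in\mathbb{R}^{n\times m}$ is the signed incidence matrix of a directed graph with $n$ nodes and $m$ edges (no connectivity assumption). $D_j= D_{\mathrm f,j}+D_{\mathrm d,j}$. $J_2=\begin{pmatrix}0&-1\\1&0\end{pmatrix}$ is rotation by $\pi/2$, and $r(\alpha)=(\cos\alpha,\sin\alpha)^\top$. **State.** $x=(\delta,y)\in\mathbb{X}=\mathbb{M}^n\times\mathbb{R}^{10n+m}$ with $y=(i_{\mathrm{dc,n}},i_{\mathrm{dc,g}},v_{\mathrm{dc}},i,v,i_{\mathrm g},\omega_{\mathrm g},T_{\mathrm m})$, where $i_{\mathrm{dc,n}}\in\mathbb{R}^m$; $i_{\mathrm{dc,g}},v_{\mathrm{dc}},\omega_{\mathrm g},T_{\mathrm m}\in\mathbb{R}^n$; and $i=(i_1,\dots,i_n)$, $v=(v_1,\dots,v_n)$, $i_{\mathrm g}=(i_{\mathrm g,1},\dots,i_{\mathrm g,n})\in\mathbb{R}^{2n}$ with blocks in $\mathbb{R}^2$. **Closed-loop system $\dot x=K^{-1}f(x)$.** For $j=1,\dots,n$ and $k=1,\dots,m$: $$\begin{aligned} \dot\delta_j&=\omega_{\mathrm r,j}+\eta_j(v_{\mathrm{dc},j}-v_{\mathrm{dc,r},j})-\gamma_j\sin\big(\tfrac{\delta_j-\delta_{\mathrm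 r,j}}{2}\big)-\omega_{\mathrm g,j},\\ L_{\mathrm{dc},k}\,\tfrac{d}{dt}i_{\mathrm{dc,n},k}&=-(B^\top v_{\mathrm{dc}})_k-R_{\mathrm{dc},k}\,i_{\mathrm{dc,n},k},\\ \tau_{\mathrm{dc},j}\,\tfrac{d}{dt}i_{\mathrm{dc,g},j}&=i_{\mathrm{dc,r},j}-\kappa_{\mathrm{dc},j}(v_{\mathrm{dc},j}-v_{\mathrm{dc,r},j})-i_{\mathrm{dc,g},j},\\ C_{\mathrm{dc},j}\,\dot v_{\mathrm{dc},j}&=i_{\mathrm{dc,g},j}+(B\,i_{\mathrm{dc,n}})_j-G_{\mathrm{dc},j}v_{\mathrm{dc},j}-\mu_j r(\delta_j)^\top i_j,\\ L_j\,\tfrac{d}{dt}i_j&=\mu_j r(\delta_j)v_{\mathrm{dc},j}-(R_jI_2-L_j\omega_{\mathrm g,j}J_2)\,i_j-v_j,\\ C_j\,\dot v_j&=i_j-(G_jI_2-C_j\omega_{\mathrm g,j}J_2)\,v_j-i_{\mathrm g,j},\\ L_{\mathrm g,j}\,\tfrac{d}{dt}i_{\mathrm g,j}&=v_j-(R_{\mathrm g,j}I_2-L_{\mathrm g,j}\omega_{\mathrm g,j}J_2)\,i_{\mathrm g,j}-b_j\,\omega_{\mathrm g,j}\,r(0),\\ J_j\,\dot\omega_{\mathrm g,j}&=T_{\mathrm m,j}-D_{\mathrm f,j}\omega_{\mathrm g,j}-D_{\mathrm d,j}(\omega_{\mathrm g,j}-\omega_{\mathrm r,j})+b_j\,r(0)^\top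 i_{\mathrm g,j},\\ \tau_{\mathrm g,j}\,\dot T_{\mathrm m,j}&=T_{\mathrm r,j}-\kappa_{\mathrm g,j}(\omega_{\mathrm g,j}-\omega_{\mathrm r,j})-T_{\mathrm m,j}. \end{aligned}$$ **Assumption A (frequency and dc voltage regulation).** The stationary frequency $\omega_{\mathrm g}^\star$ and stationary dc voltage $v_{\mathrm{dc}}^\star$ of the system exist and coincide with the respective references; that is, the system has at least one equilibrium, and every equilibrium satisfies $\omega_{\mathrm g}^\star=\omega_{\mathrm r}$ and $v_{\mathrm{dc}}^\star=v_{\mathrm{dc,r}}$. *)

(* Defs.v *)
From HB Require Import structures.
From mathcomp Require Import all_boot all_order all_algebra.
From mathcomp Require Import generic_quotient ring_quotient.
From mathcomp Require Import all_classical all_reals all_analysis.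

Set Implicit Arguments.
Unset Strict Implicit.
Unset Printing Implicit Defensive.

Import Order.TTheory GRing.Theory Num.Theory.
Import numFieldNormedType.Exports.
Import Quotient.Exports.

Local Open Scope classical_set_scope.
Local Open Scope ring_scope.

Section Angles.
Variable R : realType.

Definition fourpi_mult : {pred R} := fun x => x / (4 * pi) \is a Num.int.

Lemma fourpi_mult_zmod_closed : zmod_closed fourpi_mult.
Proof.
split=> [|x y xI yI].
  by rewrite -[_ \in _]/(0 / (4 * pi) \is a Num.int) mul0r rpred0.
rewrite -[_ \in _]/((x - y) / (4 * pi) \is a Num.int) mulrBl.
exact: rpredB.
Qed.

HB.instance Definition _ :=
  GRing.isZmodClosed.Build R fourpi_mult fourpi_mult_zmod_closed.

(* R / 4piZ, with the quotient group structure and the quotient topology. *)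
Definition angle : Type := quotient_topology (Quotient.quot fourpi_mult).

HB.instance Definition _ := Topological.on angle.
HB.instance Definition _ := GRing.Zmodule.copy angle (Quotient.quot fourpi_mult).

Definition to_angle (x : R) : angle := (\pi_(Quotient.quot fourpi_mult) x)%qT.
Definition of_angle (a : angle) : R := repr (a : Quotient.quot fourpi_mult).

(* These are independent of the representative chosen by [of_angle]: see
   [sin_halfE] and [rotE]. *)
Definition sin_half (a : angle) : R := sin (of_angle a / 2).

Definition rvec (x : R) : 'cV[R]_2 :=
  \col_(k < 2) if k == 0 then cos x else sin x.

Definition rot (a : angle) : 'cV[R]_2 := rvec (of_angle a).

Lemma to_angleK : cancel of_angle to_angle.
Proof. exact: reprK. Qed.

Lemma to_angleB : {morph to_angle : x y / x - y}.
Proof.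
move=> x y; rewrite /to_angle.
exact: (raddfB (\pi_(Quotient.quot fourpi_mult))%qT).
Qed.

Lemma eq_to_angle (x y : R) :
  to_angle x = to_angle y <-> exists k : int, x = y + k%:~R * (4 * pi).
Proof.
have p0 : 4 * pi != 0 :> R by rewrite mulf_neq0 ?gt_eqF ?pi_gt0.
have quotE : (to_angle x == to_angle y :> Quotient.quot fourpi_mult)
    = ((x - y) / (4 * pi) \is a Num.int).
  exact: (esym (Quotient.idealrBE fourpi_mult x y)).
split=> [xy|[k xy]].
  have /intrP[k xyk] : (x - y) / (4 * pi) \is a Num.int.
    by rewrite -quotE xy eqxx.
  by exists k; rewrite -xyk mulfVK // addrC subrK.
have /eqP : (to_angle x == to_angle y :> Quotient.quot fourpi_mult); last by [].
by rewrite quotE xy addrAC subrr add0r mulfK.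
Qed.

Lemma sin_cos_2piZ (x : R) (k : int) :
  (sin (x + k%:~R * (2 * pi)) = sin x) * (cos (x + k%:~R * (2 * pi)) = cos x).
Proof.
have nat_case (y : R) (l : nat) :
    (sin (y + l%:R * (2 * pi)) = sin y) * (cos (y + l%:R * (2 * pi)) = cos y).
  rewrite [2 * pi]mulr_natl; elim: l => [|l IHl]; first by rewrite mul0r addr0.
  by rewrite -natr1 mulrDl mul1r addrA sinD2pi cosD2pi !IHl.
case: k => l; first exact: nat_case.
rewrite NegzE mulrNz mulNr.
by have := nat_case (x - l.+1%:R * (2 * pi)) l.+1; rewrite subrK => -[-> ->].
Qed.

Lemma sin_halfE (x : R) : sin_half (to_angle x) = sin (x / 2).
Proof.
rewrite /sin_half; have [k] := (eq_to_angle x (of_angle (to_angle x))).1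
  (esym (to_angleK (to_angle x))).
move: (of_angle _) => y ->; rewrite mulrDl -mulrA.
have -> : 4 * pi / 2 = 2 * pi :> R.
  by rewrite mulrAC (natrM _ 2 2) mulfK.
by rewrite sin_cos_2piZ.
Qed.

Lemma rotE (x : R) : rot (to_angle x) = rvec x.
Proof.
rewrite /rot /rvec; have [k] := (eq_to_angle x (of_angle (to_angle x))).1
  (esym (to_angleK (to_angle x))).
move: (of_angle _) => y ->; apply/matrixP => i j; rewrite !mxE.
have -> : k%:~R * (4 * pi) = (k * 2)%:~R * (2 * pi) :> R.
  by rewrite intrM -mulrA [_ * (2 * pi)]mulrA -natrM.
by case: ifP; rewrite sin_cos_2piZ.
Qed.

End Angles.

Section System.
Variables (R : realType) (n m : nat).

(* line_L, line_R are the ac line constants L_g, R_g; conv_L, conv_R, conv_C,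
   conv_G are the converter filter constants L, R, C, G; net_L, net_R are the dc
   line constants L_dc, R_dc; edge k of the dc network goes from [edge_src k] to
   [edge_tgt k]. *)
Record params := Params {
  grid_J : 'I_n -> R; grid_Df : 'I_n -> R; grid_Dd : 'I_n -> R;
  grid_tau : 'I_n -> R; grid_kappa : 'I_n -> R; grid_b : 'I_n -> R;
  line_L : 'I_n -> R; line_R : 'I_n -> R;
  dc_tau : 'I_n -> R; dc_kappa : 'I_n -> R; dc_C : 'I_n -> R; dc_G : 'I_n -> R;
  conv_L : 'I_n -> R; conv_R : 'I_n -> R; conv_C : 'I_n -> R; conv_G : 'I_n -> R;
  eta : 'I_n -> R; gamma : 'I_n -> R; mu : 'I_n -> R;
  net_L : 'I_m -> R; net_R : 'I_m -> R;
  edge_src : 'I_m -> 'I_n; edge_tgt : 'I_m -> 'I_n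
}.

Record admissible (p : params) : Prop := Admissible {
  node_pos : forall j : 'I_n,
    [/\ [/\ 0 < grid_J p j, 0 < grid_Df p j & 0 < grid_Dd p j],
        [/\ 0 < grid_tau p j, 0 < grid_kappa p j & 0 < grid_b p j],
        0 < line_L p j & 0 < line_R p j];
  conv_pos : forall j : 'I_n,
    [/\ [/\ 0 < dc_tau p j, 0 < dc_kappa p j, 0 < dc_C p j & 0 < dc_G p j],
        [/\ 0 < conv_L p j, 0 < conv_R p j, 0 < conv_C p j & 0 < conv_G p j],
        0 < eta p j & 0 < gamma p j];
  mu_range : forall j : 'I_n, 0 <= mu p j <= 2^-1;
  net_pos : forall k : 'I_m, 0 < net_L p k /\ 0 < net_R p k
}.

(* Signed incidence matrix. Parallel edges are allowed, and a self-loop would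
   give a zero column; reversing all edges gives the opposite sign convention. *)
Definition incidence (p : params) : 'M[R]_(n, m) :=
  \matrix_(j, k) ((j == edge_src p k)%:R - (j == edge_tgt p k)%:R).

Record refs := Refs {
  delta_r : 'cV[angle R]_n;
  omega_r : 'cV[R]_n;
  T_r : 'cV[R]_n;
  idc_r : 'cV[R]_n;
  vdc_r : 'cV[R]_n
}.

(* y = (i_dc,n, i_dc,g, v_dc, i, v, i_g, omega_g, T_m); column [j] of each of
   the 2 x n matrices i, v, i_g is the R^2-block of index [j]. Nested pairs,
   rather than a record, so that the product topology and the componentwise
   additive structure are inherited. *)
Definition ystate : Type :=
  ('cV[R]_m * 'cV[R]_n * 'cV[R]_n * 'M[R]_(2, n) * 'M[R]_(2, n) * 'M[R]_(2, n)
   * 'cV[R]_n * 'cV[R]_n)%type.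

HB.instance Definition _ := Topological.on ystate.

Definition y_idcn (y : ystate) : 'cV[R]_m := y.1.1.1.1.1.1.1.
Definition y_idcg (y : ystate) : 'cV[R]_n := y.1.1.1.1.1.1.2.
Definition y_vdc (y : ystate) : 'cV[R]_n := y.1.1.1.1.1.2.
Definition y_i (y : ystate) : 'M[R]_(2, n) := y.1.1.1.1.2.
Definition y_v (y : ystate) : 'M[R]_(2, n) := y.1.1.1.2.
Definition y_ig (y : ystate) : 'M[R]_(2, n) := y.1.1.2.
Definition y_omega (y : ystate) : 'cV[R]_n := y.1.2.
Definition y_Tm (y : ystate) : 'cV[R]_n := y.2.

Definition state : Type := ('cV[angle R]_n * ystate)%type.
Definition tangent : Type := ('cV[R]_n * ystate)%type.

HB.instance Definition _ := Topological.on state.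

Definition J2 : 'M[R]_2 :=
  \matrix_(a, b) ((b < a)%N%:R - (a < b)%N%:R).

(* The right-hand sides f(x), before division by the storage constants. *)
Definition rhs (p : params) (r : refs) (x : state) : tangent :=
  let delta := x.1 in
  let idcn := y_idcn x.2 in let idcg := y_idcg x.2 in
  let vdc := y_vdc x.2 in
  let i := y_i x.2 in let v := y_v x.2 in let ig := y_ig x.2 in
  let omega := y_omega x.2 in let Tm := y_Tm x.2 in
  ( \col_j (omega_r r j 0 + eta p j * (vdc j 0 - vdc_r r j 0)
            - gamma p j * sin_half (delta j 0 - delta_r r j 0) - omega j 0),
    ( \col_k (- ((incidence p)^T *m vdc) k 0 - net_R p k * idcn k 0),
      \col_j (idc_r r j 0 - dc_kappa p j * (vdc j 0 - vdc_r r j 0) - idcg j 0),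
      \col_j (idcg j 0 + (incidence p *m idcn) j 0 - dc_G p j * vdc j 0
              - mu p j * ((rot (delta j 0))^T *m col j i) 0 0),
      \matrix_(a, j)
        ((mu p j * vdc j 0) *: rot (delta j 0)
         - ((conv_R p j)%:M - (conv_L p j * omega j 0) *: J2) *m col j i
         - col j v) a 0,
      \matrix_(a, j)
        (col j i
         - ((conv_G p j)%:M - (conv_C p j * omega j 0) *: J2) *m col j v
         - col j ig) a 0,
      \matrix_(a, j)
        (col j v
         - ((line_R p j)%:M - (line_L p j * omega j 0) *: J2) *m col j ig
         - (grid_b p j * omega j 0) *: rvec 0) a 0,
      \col_j (Tm j 0 - grid_Df p j * omega j 0
              - grid_Dd p j * (omega j 0 - omega_r r j 0)
              + grid_b p j * ((rvec 0)^T *m col j ig) 0 0),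
      \col_j (T_r r j 0 - grid_kappa p j * (omega j 0 - omega_r r j 0)
              - Tm j 0) ) ).

(* K^-1, where K is the block-diagonal matrix of the constants multiplying the
   time derivatives (the delta-block of K is the identity). *)
Definition Kinv (p : params) (w : tangent) : tangent :=
  ( w.1,
    ( \col_k ((net_L p k)^-1 * y_idcn w.2 k 0),
      \col_j ((dc_tau p j)^-1 * y_idcg w.2 j 0),
      \col_j ((dc_C p j)^-1 * y_vdc w.2 j 0),
      \matrix_(a, j) ((conv_L p j)^-1 * y_i w.2 a j),
      \matrix_(a, j) ((conv_C p j)^-1 * y_v w.2 a j),
      \matrix_(a, j) ((line_L p j)^-1 * y_ig w.2 a j),
      \col_j ((grid_J p j)^-1 * y_omega w.2 j 0),
      \col_j ((grid_tau p j)^-1 * y_Tm w.2 j 0) ) ).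

Definition vector_field (p : params) (r : refs) (x : state) : tangent :=
  Kinv p (rhs p r x).

Definition equilibria (p : params) (r : refs) : set state :=
  [set x | vector_field p r x = 0].

Definition regulation (p : params) (r : refs) : Prop :=
  equilibria p r !=set0 /\
  forall x, equilibria p r x ->
    y_omega x.2 = omega_r r /\ y_vdc x.2 = vdc_r r.

Definition Omega (dr : 'cV[angle R]_n) (ystar : ystate) : set state :=
  [set x : state | (forall j : 'I_n, x.1 j 0 = dr j 0 \/
                             x.1 j 0 = dr j 0 + to_angle (2 * pi))
           /\ x.2 = ystar].

End System.

(* Main.v *)
(* At an equilibrium with omega = omega_r and v_dc = v_dc,r the angle equation
   reduces to sin ((delta - delta_r) / 2) = 0, i.e. delta is delta_r or
   delta_r + 2 pi in R / 4 pi Z, and both have the same rotation vector r(delta).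
   The remaining equations determine y: the difference of two solutions of the
   ac circuit (i, v, i_g) solves the unforced circuit, whose energy balance
   R |i|^2 + G |v|^2 + R_g |i_g|^2 = 0 forces it to vanish, since the skew
   terms in J_2 do no work. All other components are then explicit. *)
Require Import Defs.
From mathcomp Require Import all_boot all_order all_algebra.
From mathcomp Require Import generic_quotient ring_quotient.
From mathcomp Require Import all_classical all_reals all_analysis.
From mathcomp Require Import ring lra.

Set Implicit Arguments.
Unset Strict Implicit.
Unset Printing Implicit Defensive.

Import Order.TTheory GRing.Theory Num.Theory.
Import numFieldNormedType.Exports.

Local Open Scope classical_set_scope.
Local Open Scope ring_scope.

(** * Angles modulo [4 * pi]: zeros of the half-angle sine, and separation of half turns *)

Section AngleTheory.
Variable R : realType.
Implicit Types (x y : R) (a b : angle R).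

Lemma to_angleD x y : to_angle (x + y) = to_angle x + to_angle y.
Proof. exact: (raddfD (\pi_(Quotient.quot (@fourpi_mult R)))%qT). Qed.

Local Notation half_turn := (to_angle (2 * pi : R)).

Lemma half_turnK a : a + half_turn + half_turn = a.
Proof.
rewrite -[a]to_angleK -!to_angleD; apply/eq_to_angle.
by exists 1; ring.
Qed.

Lemma rot_half_turn a : Defs.rot (a + half_turn) = Defs.rot a.
Proof.
rewrite -[a]to_angleK -to_angleD !rotE.
apply/matrixP => i j; rewrite !mxE.
have -> : of_angle a + 2 * pi = of_angle a + 1%:~R * (2 * pi) by rewrite mul1r.
by rewrite !sin_cos_2piZ.
Qed.

(** Subtracting a floor multiple of [2 * pi] brings [x] into [[0, 2 * pi)]. There the sine is
    positive on [(0, pi)] and, by a shift of [pi], negative on [(pi, 2 * pi)]. The residues 0 and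
    [pi] are kept apart because they yield two different angles after doubling. *)
Lemma sin_eq0_2pi x : sin x = 0 ->
  exists k : int, x = k%:~R * (2 * pi) \/ x = pi + k%:~R * (2 * pi).
Proof.
move=> sx0; have p0 : 0 < 2 * pi :> R by rewrite mulr_gt0 ?pi_gt0.
pose k := Num.floor (x / (2 * pi)); exists k.
pose y := x - k%:~R * (2 * pi).
have xE : x = y + k%:~R * (2 * pi) by rewrite subrK.
have sy : sin y = 0 by rewrite -sx0 xE sin_cos_2piZ.
have y0 : 0 <= y by rewrite subr_ge0 -ler_pdivlMr // floor_le.
have y2 : y < 2 * pi.
  have : x / (2 * pi) < k%:~R + 1 by rewrite -intrD1 floorD1_gt.
  by rewrite ltr_pdivrMr // mulrDl mul1r /y; lra.
rewrite xE; move: (k%:~R * _) y sy y0 y2 {xE sx0} => c y sy y0 y2.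
have [ypi|ypi|->] := ltgtP y pi; last by right.
- move: y0; rewrite le_eqVlt => /orP[/eqP y0|y0]; first by left; rewrite -y0 add0r.
  by have := @sin_gt0_pi R y; rewrite y0 ypi sy ltxx => /(_ isT).
- have := @sin_gt0_pi R (y - pi); rewrite subr_gt0 ypi ltrBlDr /=.
  have -> : pi + pi = 2 * pi :> R by ring.
  have := sinDpi (y - pi); rewrite subrK sy => /esym/eqP.
  rewrite oppr_eq0 => /eqP ->.
  by rewrite y2 ltxx => /(_ isT).
Qed.

Lemma sin_halfB_eq0 a b : sin_half (a - b) = 0 <-> a = b \/ a = b + half_turn.
Proof.
rewrite -[a]to_angleK -[b]to_angleK -to_angleB sin_halfE -to_angleD !eq_to_angle.
move: (of_angle a) (of_angle b) => {a b} x y.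
split=> [/sin_eq0_2pi[k [e|e]]|[[k ->]|[k ->]]].
- left; exists k; move: e => /(congr1 ( *%R^~ 2)); rewrite mulfVK // => e.
  by rewrite -[x](subrK y) e; ring.
- right; exists k; move: e => /(congr1 ( *%R^~ 2)); rewrite mulfVK // => e.
  by rewrite -[x](subrK y) e; ring.
- rewrite (_ : _ / 2 = 0 + k%:~R * (2 * pi)); last by field.
  by rewrite sin_cos_2piZ sin0.
- rewrite (_ : _ / 2 = pi + k%:~R * (2 * pi)); last by field.
  by rewrite sin_cos_2piZ sinpi.
Qed.

(** The function [cos ((b - a) / 2)] is [4 * pi]-periodic in [b], so it descends to a continuous
    function on the quotient. It equals 1 at [a] and -1 at the half turn of [a], so the set where it
    is positive separates them. *)
Lemma near_neq_half_turn a : \forall b \near a, b <> a + half_turn.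
Proof.
pose g x := cos ((x - of_angle a) / 2).
have gE x y : to_angle x = to_angle y -> g x = g y.
  move=> /eq_to_angle[k ->]; rewrite /g.
  rewrite (_ : _ / 2 = (y - of_angle a) / 2 + k%:~R * (2 * pi)); last by field.
  by rewrite sin_cos_2piZ.
have gc : continuous g.
  move=> x; apply: (@continuous_comp _ _ _ (fun x => (x - of_angle a) / 2)).
    by apply: cvgMl; apply: cvgB; [exact: cvg_id | exact: cvg_cst].
  exact: continuous_cos.
have fc : continuous (fun b : angle R => g (of_angle b)).
  apply: (@repr_comp_continuous _ _ _ g gc) => x y /eqP xy; apply/eqP.
  exact: gE.
have : 0 < g (of_angle a) by rewrite /g subrr mul0r cos0.
move=> /(cvgr_gt _ (fc a)); apply: filterS => b /= + ba.
rewrite {}ba (gE _ (of_angle a + 2 * pi)); last first.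
  by rewrite to_angleK to_angleD to_angleK.
rewrite /g (_ : _ / 2 = pi); last by field.
by rewrite cospi oppr_gt0 ltr10.
Qed.

End AngleTheory.

(** * Energy balance of the unforced ac circuit *)

Lemma passive_circuit_eq0 (R : realType) (ru rv rw a b c : R)
    (u v w : 'cV[R]_2) : 0 < ru -> 0 < rv -> 0 < rw ->
  (ru%:M - a *: J2 R) *m u + v = 0 ->
  (rv%:M - b *: J2 R) *m v + w = u ->
  (rw%:M - c *: J2 R) *m w = v ->
  [/\ u = 0, v = 0 & w = 0].
Proof.
move=> ru0 rv0 rw0 /matrixP Eu /matrixP Ev /matrixP Ew.
have := Eu 0 0; have := Eu 1 0; have := Ev 0 0; have := Ev 1 0.
have := Ew 0 0; have := Ew 1 0.
rewrite !mxE !big_ord_recl !big_ord0 !mxE /= !(lift0, mulr1n, mulr0n) /=.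
rewrite (_ : lift ord0 ord0 = 1); last exact/val_inj.
move=> w1E w0E v1E v0E u1E u0E.
have energy : ru * (u 0 0 ^+ 2 + u 1 0 ^+ 2) + rv * (v 0 0 ^+ 2 + v 1 0 ^+ 2)
    + rw * (w 0 0 ^+ 2 + w 1 0 ^+ 2) = 0.
  move: (u 0 0) (u 1 0) (v 0 0) (v 1 0) (w 0 0) (w 1 0) w1E w0E v1E v0E u1E u0E.
  move=> u0 u1 v0 v1 w0 w1 w1E w0E v1E v0E u1E u0E.
  (* These zeros are the right-hand sides of the [u] equation, paired with [u]. Expanding them and
     eliminating [u], then [v], leaves a polynomial identity in [w0] and [w1]. *)
  transitivity (u0 * 0 + u1 * 0 : R); last by rewrite !mulr0 addr0.
  by rewrite -[in u0 * 0]u0E -[in u1 * 0]u1E -v1E -v0E -w1E -w0E; ring.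
have sq0 (z : 'cV[R]_2) : z 0 0 ^+ 2 + z 1 0 ^+ 2 = 0 -> z = 0.
  move=> /eqP; rewrite paddr_eq0 ?sqr_ge0 // !sqrf_eq0 => /andP[/eqP z0 /eqP z1].
  apply/matrixP => i j; rewrite mxE (ord1 j).
  by case: (unliftP 0 i) => [k|] ->; rewrite ?(ord1 k) // -z1;
    congr (z _ _); apply/val_inj.
have pos (k x y : R) : 0 < k -> 0 <= k * (x ^+ 2 + y ^+ 2).
  by move=> k0; rewrite mulr_ge0 ?addr_ge0 ?sqr_ge0 ?ltW.
move/eqP: energy; rewrite !paddr_eq0 ?addr_ge0 ?pos // !mulf_eq0.
rewrite (gt_eqF ru0) (gt_eqF rv0) (gt_eqF rw0) /=.
by move=> /andP[/andP[/eqP u2 /eqP v2] /eqP w2]; split; apply: sq0.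
Qed.

(** * Equilibrium equations and what they determine *)

Section Equilibria.
Variables (R : realType) (n m : nat) (p : params R n m).
Hypothesis hp : admissible p.
Implicit Types (r : refs R n) (x : state R n m).

Lemma Kinv_eq0 w : Kinv p w = 0 -> w = 0.
Proof.
have scol q (c : 'I_q -> R) (z : 'cV[R]_q) : (forall j, 0 < c j) ->
    \col_j ((c j)^-1 * z j 0) = 0 -> z = 0.
  move=> c0 /matrixP z0; apply/matrixP => j k; rewrite (ord1 k) mxE.
  have /eqP := z0 j 0; rewrite !mxE mulf_eq0 invr_eq0 gt_eqF //=.
  by move=> /eqP.
have smat (c : 'I_n -> R) (z : 'M[R]_(2, n)) : (forall j, 0 < c j) ->
    \matrix_(a, j) ((c j)^-1 * z a j) = 0 -> z = 0.
  move=> c0 /matrixP z0; apply/matrixP => a j; rewrite mxE.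
  have /eqP := z0 a j; rewrite !mxE mulf_eq0 invr_eq0 gt_eqF //=.
  by move=> /eqP.
case: w => w1 [[[[[[[z1 z2] z3] z4] z5] z6] z7] z8].
rewrite /Kinv /y_idcn /y_idcg /y_vdc /y_i /y_v /y_ig /y_omega /y_Tm /=.
case=> -> /scol-> => [|j]; last by have [] := net_pos hp j.
move=> /scol-> => [|j]; last by have [[]] := conv_pos hp j.
move=> /scol-> => [|j]; last by have [[]] := conv_pos hp j.
move=> /smat-> => [|j]; last by have [_ []] := conv_pos hp j.
move=> /smat-> => [|j]; last by have [_ []] := conv_pos hp j.
move=> /smat-> => [|j]; last by have [_ _ ] := node_pos hp j.
move=> /scol-> => [|j]; last by have [[]] := node_pos hp j.
by move=> /scol-> => [//|j]; have [_ []] := node_pos hp j.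
Qed.

Lemma equilibriaE r x : equilibria p r x <-> rhs p r x = 0.
Proof.
split=> [/Kinv_eq0 //|x0]; rewrite /equilibria /= /vector_field x0.
rewrite /Kinv /y_idcn /y_idcg /y_vdc /y_i /y_v /y_ig /y_omega /y_Tm /=.
by do ![congr pair]; apply/matrixP => a j; rewrite !mxE ?mulr0.
Qed.

Lemma equilibria_angle r x : equilibria p r x ->
    y_omega x.2 = omega_r r -> y_vdc x.2 = vdc_r r ->
  forall j, sin_half (x.1 j 0 - delta_r r j 0) = 0.
Proof.
move=> /equilibriaE /(congr1 fst) /matrixP + omE vE j => /(_ j 0).
rewrite !mxE /= omE vE subrr mulr0 addr0 addrAC subrr sub0r => /eqP.
have [_ _ _ g0] := conv_pos hp j.
by rewrite oppr_eq0 mulf_eq0 gt_eqF //= => /eqP.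
Qed.

(** Two reference tuples are allowed, tied only through [omega_r], so that the stationary [y] is
    seen not to depend on [T_r] and [idc_r]. *)
Lemma equilibria_unique r r' x x' : equilibria p r x -> equilibria p r' x' ->
    (forall j, Defs.rot (x.1 j 0) = Defs.rot (x'.1 j 0)) ->
    omega_r r = omega_r r' -> y_omega x.2 = y_omega x'.2 -> y_vdc x.2 = y_vdc x'.2 ->
  x.2 = x'.2.
Proof.
case: x => d [[[[[[[idcn idcg] vdc] i] v] ig] om] Tm].
case: x' => d' [[[[[[[idcn' idcg'] vdc'] i'] v'] ig'] om'] Tm'].
move=> /equilibriaE + /equilibriaE; rewrite /rhs.
rewrite /y_idcn /y_idcg /y_vdc /y_i /y_v /y_ig /y_omega /y_Tm /=.
case=> _ idcnE _ vdcE iE vE igE omE _ [_ idcnE' _ vdcE' iE' vE' igE' omE' _].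
move=> rotE rr omom vdcvdc; subst om' vdc'.
have circuit j : [/\ col j i = col j i', col j v = col j v' & col j ig = col j ig'].
  have [_ _ _ rg0] := node_pos hp j.
  have [_ [_ r0 _ g0] _ _] := conv_pos hp j.
  have colE (F : 'I_n -> 'cV[R]_2) :
      \matrix_(a, j) F j a 0 = 0 -> F j = 0.
    move=> /matrixP F0; apply/matrixP => a b; rewrite (ord1 b) mxE.
    by have := F0 a j; rewrite !mxE.
  move: (colE _ iE) (colE _ iE') (colE _ vE) (colE _ vE').
  move: (colE _ igE) (colE _ igE') => /=; rewrite -rotE.
  set Mg := (line_R p j)%:M - _; set Mv := (conv_G p j)%:M - _.
  set Mi := (conv_R p j)%:M - _ => e3 e3' e1 e1' e2 e2'.
  have subE (X X' Y Y' Z Z' : 'cV[R]_2) : X - Y - Z = 0 -> X' - Y' - Z' = 0 ->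
      Y - Y' + (Z - Z') = X - X'.
    move=> /subr0_eq <- /subr0_eq <-.
    by rewrite opprB addrACA addKr (addrC Y) subrK.
  suff [] : [/\ col j i - col j i' = 0, col j v - col j v' = 0 &
      col j ig - col j ig' = 0].
    by do 3![move=> /subr0_eq ->].
  (* The forcing terms cancel in the differences: the modulated dc voltage because [vdc] and the
     rotation agree, the induced grid voltage because [om] agrees. *)
  apply: (@passive_circuit_eq0 R _ _ _ (conv_L p j * om j 0)
    (conv_C p j * om j 0) (line_L p j * om j 0)) r0 g0 rg0 _ _ _.
  - by rewrite mulmxBr (subE _ _ _ _ _ _ e1 e1') subrr.
  - by rewrite mulmxBr (subE _ _ _ _ _ _ e2 e2').
  - have := subE _ _ _ _ _ _ e3 e3'; rewrite subrr addr0 => <-.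
    by rewrite mulmxBr.
have idcnidcn : idcn = idcn'.
  apply/matrixP => k q; rewrite (ord1 q).
  have /matrixP/(_ k 0) := idcnE; have /matrixP/(_ k 0) := idcnE'.
  have [_ r0] := net_pos hp k.
  rewrite !mxE => /eqP; rewrite subr_eq0 => /eqP -> /eqP; rewrite subr_eq0.
  by move=> /eqP/(mulfI (lt0r_neq0 r0)).
subst idcn'.
have eq_cols (A A' : 'M[R]_(2, n)) : (forall j, col j A = col j A') -> A = A'.
  move=> AA'; apply/matrixP => a j.
  by have /matrixP/(_ a 0) := AA' j; rewrite !mxE.
have -> : i = i' by apply: eq_cols => j; have [] := circuit j.
have -> : v = v' by apply: eq_cols => j; have [] := circuit j.
have igig : ig = ig' by apply: eq_cols => j; have [] := circuit j.
(* The frequency balance, which is free of [T_r], gives [Tm] from [ig]. *)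
have -> : Tm = Tm'.
  apply/matrixP => j q; rewrite (ord1 q).
  have /matrixP/(_ j 0) := omE; have /matrixP/(_ j 0) := omE'.
  by rewrite igig !mxE rr => e e'; lra.
rewrite igig; congr (_, _, _, _, _, _, _, _).
(* Only [idcg] remains; the dc voltage balance, free of [idc_r], gives it. *)
apply/matrixP => j q; rewrite (ord1 q).
have /matrixP/(_ j 0) := vdcE; have /matrixP/(_ j 0) := vdcE'.
have [ii _ _] := circuit j.
by rewrite !mxE rotE ii => e e'; lra.
Qed.

End Equilibria.

(** * The equilibrium set and its isolated points *)

Theorem theorem1 (R : realType) (n m : nat) (hn : (0 < n)%N) (hm : (0 < m)%N)
    (p : params R n m) (hp : admissible p) :
  exists Y : 'cV[angle R]_n -> 'cV[R]_n -> 'cV[R]_n -> ystate R n m,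
  forall r : refs R n, (forall j, 0 < omega_r r j 0) -> regulation p r ->
    let ystar := Y (delta_r r) (vdc_r r) (omega_r r) in
    [/\ equilibria p r = Omega (delta_r r) ystar,
        (forall y, equilibria p r = Omega (delta_r r) y -> y = ystar),
        (forall x, Omega (delta_r r) ystar x ->
           isolated (Omega (delta_r r) ystar) x) &
        (forall x x', Omega (delta_r r) ystar x ->
           Omega (delta_r r) ystar x' -> x.2 = x'.2)].
Proof.
(* Any equilibrium value of y with these references will do: by
   equilibria_unique it does not depend on T_r and i_dc,r. *)
pose S dr v w := [set y : ystate R n m | exists r, [/\ regulation p r,
  delta_r r = dr, vdc_r r = v, omega_r r = w & equilibria p r (dr, y)]].
(* The zero default is returned only when [S dr v w] is empty, which [regulation] rules out. *)
exists (fun dr v w => xget (0, 0, 0, 0, 0, 0, 0, 0) (S dr v w)) => r _ reg ystar.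
have [[x0 ex0] regE] := reg.
have rot_eq x (ex : equilibria p r x) j :
    Defs.rot (x.1 j 0) = Defs.rot (delta_r r j 0).
  have [xw xv] := regE x ex.
  have /sin_halfB_eq0[->|->] // := equilibria_angle hp ex xw xv j.
  exact: rot_half_turn.
(* The right-hand side sees the angles only through [sin_half] and [rot], and these take the same
   values at [x] and [x0]. *)
have Omega_eq x y : Omega (delta_r r) y x -> y = x0.2 -> equilibria p r x.
  move=> Ox yx; have [xw xv] := regE _ ex0; apply/(equilibriaE hp).
  have /(equilibriaE hp) ex0' := ex0.
  rewrite -[RHS]ex0' /rhs Ox.2 yx; congr pair.
    apply/matrixP => j k; rewrite !mxE.
    have -> : sin_half (x.1 j 0 - delta_r r j 0) = 0.
      by apply/sin_halfB_eq0; exact: Ox.1.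
    by rewrite (equilibria_angle hp ex0).
  have E j : Defs.rot (x.1 j 0) = Defs.rot (x0.1 j 0).
    by rewrite (rot_eq _ ex0); have [->|->] := Ox.1 j; rewrite ?rot_half_turn.
  by congr (_, _, _, _, _, _, _, _); apply/matrixP => a j;
    rewrite [LHS]mxE [RHS]mxE ?E.
have ystarE : ystar = x0.2.
  have : S (delta_r r) (vdc_r r) (omega_r r) ystar.
    apply: (@xgetPex _ _ (S _ _ _)); exists x0.2, r; split => //.
    by apply: (Omega_eq _ x0.2); first by split => // j; left.
  (* The chosen value is stationary for some [r'] that may differ from [r] in [T_r] and [idc_r]. *)
  move=> [r' [reg' dr' vr' wr' ey]].
  have [/= yw yv] := reg'.2 _ ey; have [xw xv] := regE _ ex0.
  apply: (equilibria_unique hp ey ex0) => /=.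
  - by move=> j; rewrite rot_eq.
  - exact: wr'.
  - by rewrite yw xw.
  - by rewrite yv xv.
have EqE : equilibria p r = Omega (delta_r r) ystar.
  apply/seteqP; split=> x; last by move=> /Omega_eq; apply.
  move=> ex; have [xw xv] := regE _ ex; have [x0w x0v] := regE _ ex0; split.
    by move=> j; apply/sin_halfB_eq0; apply: (equilibria_angle hp ex xw xv).
  rewrite ystarE; apply: (equilibria_unique hp ex ex0).
  - by move=> j; rewrite !rot_eq.
  - by [].
  - by rewrite xw x0w.
  - by rewrite xv x0v.
split=> //.
- move=> y; rewrite EqE => /seteqP[/(_ (delta_r r, ystar)) + _].
  by case=> //=; split => // j; left.
- move=> x Ox; split; first exact/mem_set.
  (* At each index the two admissible angles are half turns of each other, so a point of [Omega]
     other than [x] has some angle a half turn away from that of [x], and [V] excludes it. *)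
  pose V := [set d : 'cV[angle R]_n | forall j,
    d j 0 <> x.1 j 0 + to_angle (2 * pi)].
  exists (V `*` setT).
    exists (V, setT) => //; split => /=; last exact: filterT.
    exists (fun j k => [set a | a <> x.1 j k + to_angle (2 * pi)]).
      by move=> j k; exact: near_neq_half_turn.
    by move=> d dV j; exact: dV.
  apply/seteqP; split=> x' /=.
    move=> [[Vx' _] Ox']; rewrite [x']surjective_pairing [x]surjective_pairing.
    rewrite Ox'.2 Ox.2; congr pair; apply/matrixP => j k; rewrite (ord1 k).
    have := Vx' j.
    have [->|->] := Ox'.1 j; have [->|->] := Ox.1 j => //.
    by rewrite half_turnK.
  move=> ->; split=> //; split=> // j.
  exact: nbhs_singleton (near_neq_half_turn (x.1 j 0)).
- by move=> x x' [_ ->] [_ ->].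
Qed.
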